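(* Let $A=\{a,b,c,d,f,g\}$ be a six-element set (the six listed elements are pairwise distinct), and define the following quasiorders of $A$, where $\vee$ denotes the join in the quasiorder lattice $\mathrm{Quo}(A)$: $$\alpha:=e(d,f)\vee e(f,g),\qquad \beta:=\alpha\vee e(b,c)\vee q(b,a),$$ $$\gamma:=e(a,b)\vee e(a,d)\vee e(c,f),\qquad \delta:=e(b,c)\vee e(c,g)\vee e(a,f).$$ Then $\{\alpha,\beta,\gamma,\delta\}$ is a $(1+1+2)$-generating set of the lattice $\mathrm{Quo}(A)$. Hence $\mathrm{Quo}(6)$ is $(1+1+2)$-generated.
   Context: A quasiorder (preorder) of a set $A$ is a reflexive and transitive relation $\rho\subseteq A^2$. The set $\mathrm{Quo}(A)$ of all quasiorders of $A$, ordered by set inclusion, is a lattice, called the quasiorder lattice of $A$: the meet is $\rho\wedge\tau=\rho\cap\tau$ and the join $\rho\vee\tau$ is the transitive closure of $\rho\cup\tau$. For $n$ a positive integer, $\mathrm{Quo}(n)$ denotes (up to isomorphism) $\mathrm{Quo}(A)$ for an $n$-element set $A$. Let $\Delta=\{\langle x,x\rangle : x\in A\}$. For $x,y\in A$ put $q(x,y)=\{\langle x,y\rangle\}\cup\Delta$ and $e(x,y)=e(y,x)=\{\langle x,y\rangle,\langle y,x\rangle\}\cup\Delta$. A four-element subset $X$ of a poset $Y$ is a $(1+1+2)$-subset of $Y$ if exactly two elements of $X$ are comparable (that is, exactly one unordered pair of distinct elements of $X$ is comparable). A $(1+1+2)$-generating set of a lattice $L$ is a $(1+1+2)$-subset $X$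 of $L$ that generates $L$ (the smallest sublattice of $L$, i.e. subset closed under binary $\wedge$ and $\vee$, containing $X$ is $L$ itself). A lattice is $(1+1+2)$-generated if it has a $(1+1+2)$-generating set. *)

(* Defs.v *)
From HB Require Import structures.
From mathcomp Require Import all_boot all_order.

Set Implicit Arguments.
Unset Strict Implicit.
Unset Printing Implicit Defensive.

Import Order.TTheory.
Local Open Scope order_scope.

Section QuasiorderLattice.
Variable A : finType.
Implicit Types r s t : {set A * A}.

Definition quasiorderb r : bool :=
  [forall x, (x, x) \in r]
  && [forall x, forall y, forall z,
        ((x, y) \in r) && ((y, z) \in r) ==> ((x, z) \in r)].

Lemma quasiorderP r :
  reflect ((forall x, (x, x) \in r) /\
           (forall x y z, (x, y) \in r -> (y, z) \in r -> (x, z) \in r))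
          (quasiorderb r).
Proof.
apply: (iffP andP) => -[rr tr]; split.
- exact/forallP.
- move=> x y z xy yz; move/forallP/(_ x)/forallP/(_ y)/forallP/(_ z): tr.
  by rewrite xy yz.
- exact/forallP.
- apply/forallP=> x; apply/forallP=> y; apply/forallP=> z; apply/implyP.
  by case/andP; apply: tr.
Qed.

Record quo : predArgType := Quo {
  quo_rel : {set A * A};
  quo_relP : quasiorderb quo_rel
}.

HB.instance Definition _ := [isSub for quo_rel].
HB.instance Definition _ := [Finite of quo by <:].

Lemma quo_refl (r : quo) x : (x, x) \in quo_rel r.
Proof. by case/quasiorderP: (quo_relP r). Qed.

Lemma quo_trans (r : quo) x y z :
  (x, y) \in quo_rel r -> (y, z) \in quo_rel r -> (x, z) \in quo_rel r.
Proof. by case/quasiorderP: (quo_relP r) => _; apply. Qed.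

Fact quo_display : Order.disp_t. Proof. exact: (Order.Disp tt tt). Qed.

Definition quo_le (r s : quo) : bool := quo_rel r \subset quo_rel s.

Fact quo_le_refl : reflexive quo_le.
Proof. by move=> r; apply: subxx. Qed.

Fact quo_le_anti : antisymmetric quo_le.
Proof.
by move=> r s /andP[rs sr]; apply/val_inj/eqP; rewrite eqEsubset; apply/andP.
Qed.

Fact quo_le_trans : transitive quo_le.
Proof. by move=> s r t; apply: subset_trans. Qed.

HB.instance Definition _ := Order.Le_isPOrder.Build quo_display quo
  quo_le_refl quo_le_anti quo_le_trans.

Fact quo_meet_subproof (r s : quo) : quasiorderb (quo_rel r :&: quo_rel s).
Proof.
apply/quasiorderP; split=> [x | x y z]; first by rewrite inE !quo_refl.
rewrite !inE => /andP[rxy sxy] /andP[ryz syz].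
by rewrite (quo_trans rxy ryz) (quo_trans sxy syz).
Qed.

Definition quo_meet (r s : quo) : quo := Quo (quo_meet_subproof r s).

(* [connect] is the reflexive transitive closure; it is the transitive closure
   when applied to the union of two reflexive relations. *)
Definition quo_join_rel r s : {set A * A} :=
  [set p | connect (fun x y => (x, y) \in r :|: s) p.1 p.2].

Fact quo_join_subproof (r s : quo) :
  quasiorderb (quo_join_rel (quo_rel r) (quo_rel s)).
Proof.
apply/quasiorderP; split=> [x | x y z]; rewrite !inE; first exact: connect0.
exact: connect_trans.
Qed.

Definition quo_join (r s : quo) : quo := Quo (quo_join_subproof r s).

Fact quo_lexI (t r s : quo) :
  (t <= quo_meet r s) = (t <= r) && (t <= s).
Proof. exact: subsetI. Qed.

Fact quo_leUx (r s t : quo) :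
  (quo_join r s <= t) = (r <= t) && (s <= t).
Proof.
apply/idP/idP => [/subsetP jt | /andP[/subsetP rt /subsetP st]].
  by apply/andP; split; apply/subsetP=> -[x y] xy;
    apply: jt; rewrite inE; apply: connect1; rewrite inE xy ?orbT.
apply/subsetP=> -[x y]; rewrite inE => /connectP[p /= + ->].
elim: p x => [|z p IHp] x /=; first by move=> _; apply: quo_refl.
case/andP=> xz zp; apply: quo_trans (IHp z zp).
by move: xz; rewrite inE => /orP[/rt | /st].
Qed.

HB.instance Definition _ :=
  Order.POrder_MeetJoin_isLattice.Build quo_display quo quo_lexI quo_leUx.

Definition q_rel (x y : A) : {set A * A} :=
  (x, y) |: [set p | p.1 == p.2].

Definition e_rel (x y : A) : {set A * A} :=
  (x, y) |: ((y, x) |: [set p | p.1 == p.2]).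

Fact q_subproof x y : quasiorderb (q_rel x y).
Proof.
apply/quasiorderP; split=> [u | u v w]; rewrite !inE !xpair_eqE /=.
  by rewrite eqxx orbT.
case/orP=> [/andP[/eqP-> /eqP->] | /eqP->] //.
by case/orP=> [/andP[_ /eqP->] | /eqP<-]; rewrite !eqxx.
Qed.

Fact e_subproof x y : quasiorderb (e_rel x y).
Proof.
apply/quasiorderP; split=> [u | u v w]; rewrite !inE !xpair_eqE /=.
  by rewrite eqxx !orbT.
case/or3P=> [/andP[/eqP-> /eqP->] | /andP[/eqP-> /eqP->] | /eqP->] //;
by case/or3P=> [/andP[_ /eqP->] | /andP[_ /eqP->] | /eqP<-];
  rewrite !eqxx ?orbT.
Qed.

Definition q (x y : A) : quo := Quo (q_subproof x y).
Definition e (x y : A) : quo := Quo (e_subproof x y).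

End QuasiorderLattice.

Definition is_112_subset (d : Order.disp_t) (P : finPOrderType d)
    (X : {set P}) : bool :=
  (#|X| == 4) &&
  (#|[set Y : {set P} | [&& Y \subset X, #|Y| == 2 &
        [forall x in Y, forall y in Y, x >=< y]]]| == 1).

Section Generation.
Variables (d : Order.disp_t) (L : finLatticeType d).
Implicit Types X S : {set L}.

Definition is_sublattice S : bool :=
  [forall x in S, forall y in S, (x `&` y \in S) && (x `|` y \in S)].

Definition generated_sublattice X : {set L} :=
  \bigcap_(S : {set L} | is_sublattice S && (X \subset S)) S.

Definition is_112_generating_set X : bool :=
  is_112_subset X && (generated_sublattice X == [set: L]).

Definition is_112_generated : bool :=
  [exists X : {set L}, is_112_generating_set X].

End Generation.

Arguments is_112_generated {d} L.

(* Main.v *)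
Require Import Defs.
From mathcomp Require Import all_boot all_order.

(** Write [q x y] for the least quasiorder in which [x] lies below [y]. Every
    quasiorder of a finite set is a join of such elements, so a sublattice of
    [quo A] is the whole lattice as soon as it contains all of them.

    It is enough to have them for the neighbours on a cycle through all of [A],
    in both directions ([sublattice_cycle_full]). Indeed, the cycle joins [x] to
    [y] along two internally disjoint arcs; the join of the steps of either arc
    has [x] below [y] and otherwise relates only points of that arc, so the meet
    of the two joins is [q x y] ([q_path_ub] bounds the join over an arc).

    For the four given quasiorders the cycle is a - d - b - c - g - f - a. Its
    twelve elements [q x y] are obtained, by successive meets and joins, from
    [q b a = beta `&` gamma] and the generators; most have the shape
    [r `&` (s `|` t)], where [s] is a generator whose blocks carry
    the few pairs of [t] to exactly one pair that [r] keeps. Each of these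
    equations is a finite computation: quasiorders of a set enumerated by
    0, ..., n - 1 are described by Boolean matrices, on which meet is entrywise
    conjunction and join is the transitive closure of the union
    ([describes_meet], [describes_join]). The same matrices decide which of the
    generators are comparable, and [is_112_subset_set4] turns this into the
    (1+1+2) condition. The statement on six-element sets follows by enumerating
    such a set. *)

Set Implicit Arguments.
Unset Strict Implicit.
Unset Printing Implicit Defensive.

Import Order.TTheory.
Local Open Scope order_scope.

(** * Four-element subsets with one comparable pair *)

Lemma is_112_subset_set4 (d : Order.disp_t) (P : finPOrderType d)
    (x y z w : P) :
  x < y -> x >< z -> x >< w -> y >< z -> y >< w -> z >< w ->
  is_112_subset [set x; y; z; w].
Proof.
move=> xy xz xw yz yw zw.
have neq (u t : P) : u >< t -> u != t.
  by apply: contraNneq => ->; apply: comparablexx.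
apply/andP; split.
  rewrite setUC cardsU1 setUC cardsU1 setUC cardsU1 cards1 !inE !(eq_sym w).
  by rewrite !(eq_sym z) (eq_sym y) !negb_or (lt_eqF xy) !neq //;
    rewrite comparable_sym.
apply/cards1P; exists [set x; y]; apply/setP=> Y; rewrite !inE.
apply/and3P/eqP => [[sYX /cards2P[u [t [ut YE]]] cmpY] | ->].
  have uY : u \in Y by rewrite YE set21.
  have tY : t \in Y by rewrite YE set22.
  have {cmpY} := forall_inP (forall_inP cmpY u uY) t tY.
  move: ut; rewrite {}YE in sYX *; move: sYX; rewrite subUset !sub1set !inE.
  rewrite -!orbA => /andP[/or4P[]/eqP-> /or4P[]/eqP->];
    rewrite ?eqxx // => _; rewrite ?(negbTE xz, negbTE xw, negbTE yz,
      negbTE yw, negbTE zw) // 1?comparable_sym ?(negbTE xz, negbTE xw,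
      negbTE yz, negbTE yw, negbTE zw) //.
  by rewrite setUC.
have cmp_xy: [forall u in [set x; y], forall t in [set x; y], u >=< t].
  apply/forall_inP=> u; rewrite !inE => /orP[] /eqP->;
  apply/forall_inP=> t; rewrite !inE => /orP[] /eqP->;
  by rewrite ?comparablexx ?(le_comparable (ltW xy)) ?(ge_comparable (ltW xy)).
rewrite cmp_xy cards2 (lt_eqF xy) subUset !sub1set !inE !eqxx !orbT.
by split.
Qed.

(** * Sublattices of the quasiorder lattice *)

Section QuoLattice.
Variable A : finType.
Implicit Types (x y : A) (r s : quo A) (S : {set quo A}) (U W : {set A}).

Lemma quo_leP r s :
  reflect (forall x y, (x, y) \in quo_rel r -> (x, y) \in quo_rel s) (r <= s).
Proof. by apply: (iffP subsetP) => [h x y /h | h [x y] /h]. Qed.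

Lemma mem_quoI r s p :
  (p \in quo_rel (r `&` s)) = (p \in quo_rel r) && (p \in quo_rel s).
Proof. by rewrite inE. Qed.

Lemma mem_q x y : (x, y) \in quo_rel (q x y).
Proof. by rewrite !inE eqxx. Qed.

Lemma q_leE x y r : (q x y <= r) = ((x, y) \in quo_rel r).
Proof.
apply/quo_leP/idP => [-> // | rxy u v]; first exact: mem_q.
by rewrite !inE /= => /orP[/eqP[-> ->] // | /eqP->]; apply: quo_refl.
Qed.

(** The pairs of a rectangle [U * W] compose to pairs of the same rectangle, so
    adding the diagonal yields a quasiorder, whatever [U] and [W] are. These are
    the upper bounds used for joins along a path. *)
Definition rect_rel U W : {set A * A} := [set p | p.1 == p.2] :|: setX U W.

Fact rect_subproof U W : quasiorderb (rect_rel U W).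
Proof.
apply/quasiorderP; split=> [x | x y z]; rewrite !inE /= ?eqxx //.
case/orP=> [/eqP-> // | /andP[-> yW]] /orP[/eqP<- | /andP[_ ->]].
  by rewrite yW orbT.
by rewrite orbT.
Qed.

Definition rect U W := Quo (rect_subproof U W).

Lemma mem_rect U W x y :
  ((x, y) \in quo_rel (rect U W)) = (x == y) || (x \in U) && (y \in W).
Proof. by rewrite !inE. Qed.

Lemma rect_mono U U' W W' :
  U \subset U' -> W \subset W' -> rect U W <= rect U' W'.
Proof.
move=> /subsetP sU /subsetP sW; apply/quo_leP=> x y; rewrite !mem_rect.
by case/orP=> [-> // | /andP[/sU-> /sW->]]; rewrite orbT.
Qed.

Variable S : {set quo A}.
Hypothesis latS : is_sublattice S.

Lemma sublattice_meet r s : r \in S -> s \in S -> r `&` s \in S.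
Proof.
by move=> rS sS; case/andP: (forall_inP (forall_inP latS r rS) s sS).
Qed.

Lemma sublattice_join r s : r \in S -> s \in S -> r `|` s \in S.
Proof.
by move=> rS sS; case/andP: (forall_inP (forall_inP latS r rS) s sS).
Qed.

(** A quasiorder is the join of the [q x y] over its pairs; the proof adds the
    pairs one at a time, starting from the diagonal [q x0 x0]. *)
Lemma sublattice_q_full (x0 : A) :
  (forall x y, q x y \in S) -> S = [set: quo A].
Proof.
move=> qS; apply/setP=> r; rewrite inE.
have join_q (l : seq (A * A)) : {subset l <= quo_rel r} ->
    exists2 s, s \in S & s <= r /\ {subset l <= quo_rel s}.
  elim: l => [_ | [x y] l IHl lr].
    by exists (q x0 x0) => //; rewrite q_leE quo_refl.
  have [|s Ss [sr ls]] := IHl; first by move=> p lp; rewrite lr // inE lp orbT.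
  exists (q x y `|` s); first exact: sublattice_join.
  split=> [|p]; first by rewrite leUx sr q_leE lr // inE eqxx.
  rewrite inE => /predU1P[-> | /ls]; first by rewrite -q_leE leUl.
  by apply: (subsetP (_ : quo_le s _)); apply: (leUr s).
have [|s Ss [sr rs]] := join_q (enum (quo_rel r)).
  by move=> p; rewrite mem_enum.
suff -> : r = s by [].
apply/le_anti; rewrite sr andbT; apply/quo_leP=> x y rxy.
by apply: rs; rewrite mem_enum.
Qed.

(** The join of the [q u v] over the steps of a simple path relates its ends. As
    no step leaves the last point and none enters the first one, it relates
    distinct points only from the path without its end to the path without its
    start. *)
Lemma q_path_ub x p y :
  path (fun u v => q u v \in S) x (rcons p y) -> uniq (x :: rcons p y) ->
  exists2 r, r \in S &
    q x y <= r <= rect [set z in x :: p] [set z in rcons p y].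
Proof.
elim: p x => [|z p IHp] x /=.
  rewrite andbT => qxy _; exists (q x y); rewrite // lexx q_leE mem_rect /=.
  by rewrite !inE !eqxx orbT.
case/andP=> Sxz zpy /and3P[xNzp zNp uniq_p].
case: (IHp z zpy) => [|r Sr /andP[qr rR]]; first by rewrite /= zNp.
exists (q x z `|` r); first exact: sublattice_join.
rewrite leUx (q_leE x z) mem_rect !inE !eqxx orbT /=.
apply/andP; split; last first.
  apply: le_trans rR (rect_mono _ _); apply/subsetP=> t; rewrite !inE => ->;
  exact: orbT.
rewrite q_leE; apply: (@quo_trans _ _ _ z); rewrite -q_leE ?leUl //.
exact: le_trans qr (leUr _ _).
Qed.

(** The two arcs from [x] to [y] share only their ends, so the rectangles that
    bound the joins along them intersect in the single pair [(x, y)]. *)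
Lemma sublattice_cycle_full c :
    uniq c -> (forall x, x \in c) -> (1 < size c)%N ->
    cycle (fun x y => (q x y \in S) && (q y x \in S)) c ->
  S = [set: quo A].
Proof.
move=> uniq_c c_full c_gt1 cyc.
have Sq x y : x != y -> q x y \in S.
  move=> xy.
  have [i p1 p2 _ _ rot_c] := rot_to_arc uniq_c (c_full x) (c_full y) xy.
  have := uniq_c; rewrite -(rot_uniq i) rot_c /= mem_cat inE cat_uniq /=.
  rewrite !negb_or -!andbA => /and5P[xNp1 _ xNp2 uniq_p1].
  case/and4P=> yNp1 /hasPn p12 yNp2 uniq_p2.
  move: cyc; rewrite -(rot_cycle i) rot_c /= rcons_cat /= -cat_rcons cat_path.
  rewrite last_rcons => /andP[path1 path2].
  have [||r Sr /andP[qr rR]] := @q_path_ub x p1 y.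
  - by apply: sub_path path1 => u v /andP[].
  - by rewrite /= mem_rcons inE negb_or xy xNp1 rcons_uniq yNp1.
  (* The second arc leads from [y] to [x] along the cycle; it is walked back. *)
  have [||t St /andP[qt tR]] := @q_path_ub x (rev p2) y.
  - rewrite -rev_cons -(belast_rcons y p2 x) -{1}(last_rcons y p2 x) rev_path.
    by apply: sub_path path2 => u v /andP[].
  - rewrite /= mem_rcons inE negb_or xy mem_rev xNp2 rcons_uniq mem_rev yNp2.
    by rewrite rev_uniq.
  suff -> : q x y = r `&` t by apply: sublattice_meet.
  apply/le_anti; rewrite lexI qr qt /=; apply/quo_leP=> u v.
  rewrite mem_quoI.
  case/andP=> /(elimT (quo_leP _ _) rR) + /(elimT (quo_leP _ _) tR).
  rewrite !mem_rect !inE !mem_rcons !inE !mem_rev xpair_eqE.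
  have [-> | _] := eqVneq u v; first by rewrite orbT.
  rewrite orbF /= => /andP[up1 vp1] /andP[up2 vp2].
  have p12F w : w \in p1 -> w \in p2 -> false.
    by move=> w1 /p12; rewrite /= w1.
  apply/andP; split.
    by case: eqP up1 up2 => //= _; apply: p12F.
  by case: eqP vp1 vp2 => //= _; apply: p12F.
have [x0 [y0 xy0]] : exists x0 y0, x0 != y0.
  case: c uniq_c c_gt1 {cyc c_full} => [|x0 [|y0 c]] //=; rewrite inE negb_or.
  by case/andP=> /andP[xy _] _ _; exists x0, y0.
(* The diagonal also lies in [S]: it is the meet of two opposite atoms. *)
apply: (sublattice_q_full x0) => x y; have [->|/Sq//] := eqVneq x y.
have -> : q y y = q x0 y0 `&` q y0 x0.
  apply/le_anti; rewrite q_leE quo_refl /=; apply/quo_leP=> u v.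
  rewrite mem_quoI !inE /= !xpair_eqE.
  have [-> | _] := eqVneq u v; first by rewrite !orbT.
  rewrite !orbF => /andP[/andP[/eqP-> /eqP->] /andP[/eqP xy _]].
  by rewrite xy eqxx in xy0.
by apply: sublattice_meet; apply: Sq; rewrite // eq_sym.
Qed.

End QuoLattice.

(** * Quasiorders described by Boolean matrices *)

Section Matrices.
Variable n : nat.
Implicit Types M N K : seq bitseq.

Definition entry M i j := nth false (nth [::] M i) j.
Definition tabulate (e : rel nat) := mkseq (fun i => mkseq (e i) n) n.
Definition mx_le M N :=
  all (fun i => all (fun j => entry M i j ==> entry N i j) (iota 0 n))
    (iota 0 n).

Definition mx_q a b := tabulate (fun i j => (i == j) || (i == a) && (j == b)).
Definition mx_e a b := tabulate (fun i j =>
  [|| i == j, (i == a) && (j == b) | (i == b) && (j == a)]).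
Definition mx_meet M N := tabulate (fun i j => entry M i j && entry N i j).
Definition mx_union M N := tabulate (fun i j => entry M i j || entry N i j).
Definition mx_square M :=
  tabulate (fun i j => has (fun k => entry M i k && entry M k j) (iota 0 n)).

(** Squaring [n] times reaches paths of length [2 ^ n], more than a relation on
    [n] points needs. Instead of relying on this, the result is returned only if
    it is seen to contain the union and to be transitive, which makes the proof
    of [describes_join] independent of the number of squarings. *)
Definition mx_join M N :=
  let K := iter n mx_square (mx_union M N) in
  if mx_le (mx_union M N) K && mx_le (mx_square K) K then Some K else None.

Lemma entry_tabulate e i j :
  (i < n)%N -> (j < n)%N -> entry (tabulate e) i j = e i j.
Proof. by move=> ltin ltjn; rewrite /entry !nth_mkseq. Qed.

Lemma mx_leP M N :
  reflect (forall i j, (i < n)%N -> (j < n)%N -> entry M i j -> entry N i j)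
    (mx_le M N).
Proof.
apply: (iffP allP) => [MN i j ltin ltjn | MN i].
  move: (MN i); rewrite mem_iota => /(_ ltin)/allP/(_ j).
  by rewrite mem_iota => /(_ ltjn)/implyP.
rewrite mem_iota => ltin; apply/allP=> j; rewrite mem_iota => ltjn.
by apply/implyP; apply: MN.
Qed.

Variables (A : finType) (v : nat -> A).
Hypothesis v_inj : {in gtn n &, injective v}.
Hypothesis v_surj : forall x, exists2 i, (i < n)%N & v i = x.
Implicit Types r s : quo A.

Definition describes M r := forall i j, (i < n)%N -> (j < n)%N ->
  ((v i, v j) \in quo_rel r) = entry M i j.

Lemma describes_le M N r s : describes M r -> describes N s ->
  (r <= s) = mx_le M N.
Proof.
move=> Mr Ns; apply/quo_leP/mx_leP => [rs i j ltin ltjn | MN x y].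
  by rewrite -Mr // -Ns //; apply: rs.
have [[i ltin <-] [j ltjn <-]] := (v_surj x, v_surj y).
by rewrite Mr // Ns //; apply: MN.
Qed.

Lemma describes_eq M r s : describes M r -> describes M s -> r = s.
Proof.
move=> Mr Ms; apply/le_anti; rewrite (describes_le Mr Ms) (describes_le Ms Mr).
by rewrite andbb; apply/mx_leP.
Qed.

Lemma describes_q a b K : (a < n)%N -> (b < n)%N -> mx_q a b = K ->
  describes K (q (v a) (v b)).
Proof.
move=> ltan ltbn <- i j ltin ltjn; rewrite entry_tabulate // !inE xpair_eqE /=.
by rewrite !(inj_in_eq v_inj) // orbC.
Qed.

Lemma describes_e a b K : (a < n)%N -> (b < n)%N -> mx_e a b = K ->
  describes K (e (v a) (v b)).
Proof.
move=> ltan ltbn <- i j ltin ltjn; rewrite entry_tabulate // !inE !xpair_eqE /=.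
by rewrite !(inj_in_eq v_inj) // orbA orbC.
Qed.

Lemma describes_meet M N K r s : describes M r -> describes N s ->
  mx_meet M N = K -> describes K (r `&` s).
Proof.
move=> Mr Ns <- i j ltin ltjn.
by rewrite mem_quoI Mr // Ns // entry_tabulate.
Qed.

(** Squaring only composes related points, so the computed matrix is contained in
    the join; conversely, along a path in the union the checked transitivity
    accumulates. *)
Lemma describes_join M N K r s : describes M r -> describes N s ->
  mx_join M N = Some K -> describes K (r `|` s).
Proof.
move=> Mr Ns; rewrite /mx_join; set U := mx_union M N.
have Urs : forall i j, (i < n)%N -> (j < n)%N ->
    ((v i, v j) \in quo_rel r :|: quo_rel s) = entry U i j.
  by move=> i j ltin ltjn; rewrite inE Mr // Ns // entry_tabulate.
case: ifP => // /andP[/mx_leP UK /mx_leP Ktr] [defK].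
rewrite defK in UK Ktr; move=> i j ltin ltjn.
apply/idP/idP; last first.
  rewrite -defK; elim: {3}n i j ltin ltjn => [|m IHm] i j ltin ltjn /=.
    by rewrite -Urs // => ij; rewrite inE; apply: connect1.
  rewrite entry_tabulate // => /hasP[k]; rewrite mem_iota => ltkn /andP[ik kj].
  exact: quo_trans (IHm i k ltin ltkn ik) (IHm k j ltkn ltjn kj).
rewrite inE => /connectP[/= p]; elim: p i ltin => [|z p IHp] i ltin /=.
  move=> _ /v_inj-> //; apply: UK => //.
  by rewrite entry_tabulate // -Mr // quo_refl.
have [k ltkn <-] := v_surj z; rewrite Urs // => /andP[Uik kp] lastp.
apply: Ktr => //; rewrite entry_tabulate //; apply/hasP; exists k.
  by rewrite mem_iota.
by rewrite (UK i k) // IHp.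
Qed.

Lemma describes_mem M r s (S : {set quo A}) :
  describes M s -> describes M r -> s \in S -> r \in S.
Proof. by move=> Ms Mr; rewrite (describes_eq Mr Ms). Qed.

End Matrices.

(** * The four generators *)

(** The left-hand side is computed on its own, because the matrix to be found is
    an existential variable that refers to the whole context, which would be
    normalized along with it. *)
Ltac compute_matrix :=
  lazymatch goal with |- ?t = _ =>
    let k := eval vm_compute in t in exact (erefl k <: t = k)
  end.

Section SixElements.
Variables (A : finType) (v : nat -> A).
Hypothesis v_inj : {in gtn 6 &, injective v}.
Hypothesis v_surj : forall x, exists2 i, (i < 6)%N & v i = x.

Let a := v 0.
Let b := v 1.
Let c := v 2.
Let d := v 3.
Let f := v 4.
Let g := v 5.

Let alpha : quo A := e d f `|` e f g.
Let beta  : quo A := alpha `|` e b c `|` q b a.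
Let gamma : quo A := e a b `|` e a d `|` e c f.
Let delta : quo A := e b c `|` e c g `|` e a f.

(** Finds a matrix for a lattice expression. All matrices are kept in computed
    form, and quasiorders other than [q], [e], meets and joins are looked up in
    the context. *)
Ltac describe :=
  lazymatch goal with
  | |- describes _ _ _ (Order.meet _ _) => eapply describes_meet;
    [describe | describe | compute_matrix]
  | |- describes _ _ _ (Order.join _ _) =>
    eapply (describes_join v_inj v_surj);
    [describe | describe | compute_matrix]
  | |- describes _ _ _ (q _ _) =>
    apply: (describes_q v_inj); [exact: isT | exact: isT | compute_matrix]
  | |- describes _ _ _ (e _ _) =>
    apply: (describes_e v_inj); [exact: isT | exact: isT | compute_matrix]
  | |- _ => eassumption
  end.

(** Puts an element into a sublattice by writing it as [t], an expression in
    members of that sublattice. *)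
Ltac derive t :=
  lazymatch goal with latS : is_true (is_sublattice _) |- _ =>
    apply: (@describes_mem _ _ _ v_surj _ _ t);
    [ describe | describe
    | repeat first [assumption | apply: (sublattice_meet latS)
                   | apply: (sublattice_join latS)] ]
  end.

Lemma four_generators_112 :
  is_112_generating_set [set alpha; beta; gamma; delta].
Proof.
eassert (D_alpha : describes 6 v _ alpha)
  by (rewrite /alpha; describe).
eassert (D_beta : describes 6 v _ beta)
  by (rewrite /beta; describe).
eassert (D_gamma : describes 6 v _ gamma)
  by (rewrite /gamma; describe).
eassert (D_delta : describes 6 v _ delta)
  by (rewrite /delta; describe).
have lt_alpha_beta : alpha < beta.
  by rewrite lt_leAnge (describes_le v_surj D_alpha D_beta)
    (describes_le v_surj D_beta D_alpha).
clearbody alpha beta gamma delta.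
have incomp M N r s : describes 6 v M r -> describes 6 v N s ->
    ~~ mx_le 6 M N && ~~ mx_le 6 N M -> r >< s.
  move=> Mr Ns; rewrite /Order.comparable (describes_le v_surj Mr Ns).
  by rewrite (describes_le v_surj Ns Mr) negb_or.
apply/andP; split.
  by apply: is_112_subset_set4 => //; apply: incomp; try eassumption.
rewrite eqEsubset subsetT /=; apply/bigcapsP=> S /andP[latS].
rewrite !subUset !sub1set -!andbA => /and4P[alphaS betaS gammaS deltaS].
have q_ba : q b a \in S by derive (beta `&` gamma).
have q_gf : q g f \in S by derive (alpha `&` (delta `|` q b a)).
have q_gc : q g c \in S by derive (delta `&` (gamma `|` q g f)).
have q_cg : q c g \in S
  by derive (delta `&` (alpha `|` (gamma `&` (delta `|` q b a)))).
have q_fg : q f g \in S by derive (alpha `&` (gamma `|` q c g)).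
(* In [beta `|` q g c], [d, f, g] lie below [b, c], which lie below [a]. Hence
   [rho] turns the blocks [a, b, d] and [c, f] of [gamma] into the chains
   d < b < a and f < c. *)
pose rho := gamma `&` (beta `|` q g c).
have rho_S : rho \in S.
  by apply: (sublattice_meet latS); last exact: (sublattice_join latS).
eassert (D_rho : describes 6 v _ rho) by (rewrite /rho; describe).
clearbody rho.
(* [beta `&` delta] is [e b c]. *)
have q_cb : q c b \in S
  by derive (beta `&` delta `&` (alpha `|` q c g `|` rho)).
have q_fd : q f d \in S by derive (alpha `&` (gamma `|` q c b)).
have q_ad : q a d \in S by derive (gamma `&` (delta `|` q f d)).
have q_af : q a f \in S by derive (delta `&` (alpha `|` q a d)).
have q_bc : q b c \in S by derive (beta `&` delta `&` (q a f `|` rho)).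
have q_fa : q f a \in S by derive (delta `&` (rho `|` q f d)).
have q_da : q d a \in S by derive (rho `&` (alpha `|` q f a)).
have q_bd : q b d \in S
  by derive ((q b a `|` q a d) `&` (alpha `|` q b c `|` q c g)).
have q_bg : q b g \in S by derive ((q b c `|` q c g) `&` (alpha `|` q b d)).
have q_dg : q d g \in S by derive (alpha `&` (rho `|` q b g)).
have q_db : q d b \in S by derive (rho `&` (delta `|` q d g)).
rewrite (@sublattice_cycle_full _ S latS [:: a; d; b; c; g; f]) //.
- rewrite -[X in uniq X]/(map v [:: 0; 3; 1; 2; 5; 4]) map_inj_in_uniq //.
  by move=> i j i6 j6; apply: v_inj; [move: i i6|move: j j6]; apply/allP.
- move=> x; have [i + <-] := v_surj x.
  by case: i => [|[|[|[|[|[|]]]]]] // _; rewrite !inE eqxx ?orbT.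
by rewrite /= q_ad q_da q_db q_bd q_bc q_cb q_cg q_gc q_gf q_fg q_fa q_af.
Qed.
End SixElements.

Theorem theorem2p2 :
  (forall (A : finType) (a b c d f g : A),
     uniq [:: a; b; c; d; f; g] ->
     [set: A] = [set a; b; c; d; f; g] ->
     let alpha : quo A := e d f `|` e f g in
     let beta  : quo A := alpha `|` e b c `|` q b a in
     let gamma : quo A := e a b `|` e a d `|` e c f in
     let delta : quo A := e b c `|` e c g `|` e a f in
     is_112_generating_set [set alpha; beta; gamma; delta])
  /\ (forall B : finType, #|B| = 6 -> is_112_generated (quo B)).
Proof.
have six (A : finType) (x0 : A) (s : seq A) : size s = 6 -> uniq s ->
    (forall x, x \in s) -> {in gtn 6 &, injective (nth x0 s)} /\
    (forall x, exists2 i, (i < 6)%N & nth x0 s i = x).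
  move=> <- uniq_s s_full; split=> [i j lti ltj /eqP | x].
    by rewrite nth_uniq // => /eqP.
  by exists (index x s); [rewrite index_mem | rewrite nth_index].
split=> [A a b c d f g uniq_s A_eq | B B6].
  have [//|//|x|v_inj v_surj] := @six A a [:: a; b; c; d; f; g].
    by have := in_setT x; rewrite A_eq !inE -!orbA.
  exact: four_generators_112 v_inj v_surj.
have [x0 _ | B0] := pickP B; last by rewrite (eq_card0 B0) in B6.
have [||x|v_inj v_surj] := @six B x0 (enum B).
- by rewrite -cardE.
- exact: enum_uniq.
- exact: mem_enum.
by apply/existsP; eexists; apply: four_generators_112 v_inj v_surj.
Qed.
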